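(* Consider a planar four-bar mechanism with $l_1=l_2=l>0$, $l_3=d>0$ and $l\neq d$, with mass parameters $m_j>0$, $r_j\ge0$, $|p_j|=1$, $I_j>0$ ($j=1,2,3$), and put $q_j=m_jr_jp_j\in\mathbb{C}$ and $J_j=I_j+m_jr_j^2$. The mechanism is dynamically balanced in the mode $z_1\neq z_2$ if and only if $$q_1=\frac{l}{d}\,q_3-l\,m_3,\qquad q_2=-\frac{l}{d}\,q_3,$$ $$J_1=\frac{d^2+l^2}{d}\,q_3-J_3-l^2m_3,\qquad J_2=\frac{d^2-l^2}{d}\,q_3-J_3 .$$
   Context: Kinematics. A planar four-bar mechanism has a fixed base of length $d>0$ and three moving links of lengths $l_1,l_2,l_3>0$. In the complex plane, link 1 runs from $0$ to $l_1z_1$, link 2 from $d$ to $d+l_2z_2$, and link 3 (the coupler) from $l_1z_1$ to $l_1z_1+l_3z_3=d+l_2z_2$, where $z_j=e^{i\theta_j}$ are unit complex numbers. Put $G_1=-l_1/l_3$, $G_2=l_2/l_3$, $G_3=d/l_3$, so $z_3=G_1z_1+G_2z_2+G_3$. A configuration is a pair $(z_1,z_2)$ of unit complex numbers with $$G(z_1,z_2)=(G_1z_1+G_2z_2+G_3)(G_1z_1^{-1}+G_2z_2^{-1}+G_3)-1=0.$$ Differentiating $G=0$ in time gives $i(K_1\dot\theta_1+K_2\dot\theta_2)=0$ with $$K_1=G_1G_2(z_1z_2^{-1}-z_1^{-1}z_2)+G_1G_3(z_1-z_1^{-1}),\qquad K_2=G_1G_2(z_1^{-1}z_2-z_1z_2^{-1})+G_2G_3(z_2-z_2^{-1}).$$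 Mass parameters. Link $j$ has mass $m_j>0$, moment of inertia $I_j>0$ about its centre of mass, and centre of mass at (starting point of the link) $+\,r_jp_jz_j$, with $r_j\ge0$ and $|p_j|=1$; the starting points are $0$, $d$, $l_1z_1$ for $j=1,2,3$. Put $J_j=I_j+m_jr_j^2$. Centre of mass. The total centre of mass is $\frac{1}{m_1+m_2+m_3}(F_1z_1+F_2z_2+F_3)$ with $F_1=m_1r_1p_1+m_3l_1+G_1m_3r_3p_3$, $F_2=m_2r_2p_2+G_2m_3r_3p_3$, $F_3=m_2d+G_3m_3r_3p_3$. Angular momentum. With $\langle a,b\rangle=\mathrm{Re}(a\bar b)$, the total angular momentum is $$H=J_1\dot\theta_1+\big(\langle d,m_2r_2p_2z_2\rangle+J_2\big)\dot\theta_2+\langle l_1z_1+r_3p_3z_3,\ m_3(l_1z_1\dot\theta_1+r_3p_3z_3\dot\theta_3)\rangle+I_3\dot\theta_3.$$ Substituting $z_3=G_1z_1+G_2z_2+G_3$, $z_3\dot\theta_3=G_1z_1\dot\theta_1+G_2z_2\dot\theta_2$ and $\dot\theta_3=\langle z_3,z_3\dot\theta_3\rangle$ gives $H=K_3\dot\theta_1+K_4\dot\theta_2$, where $K_3,K_4$ are functions of $(z_1,z_2)$. Put $K=K_1K_4-K_2K_3$. Balancing. The mechanism is dynamically balanced in the mode $z_1\neq z_2$ if there is an infinite set $S$ of configurations, all satisfying $z_1\neq z_2$, such that $F_1z_1+F_2z_2$ is constant on $S$ (the centre of mass is stationary) and $K(z_1,z_2)=0$ for all $(z_1,z_2)\in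 S$ (the angular momentum vanishes). *)

(* Defs.v *)
From mathcomp Require Import all_boot all_order all_algebra.
From mathcomp Require Import complex.
From mathcomp Require Import classical_sets cardinality reals.
From mathcomp Require Import ring.

Set Implicit Arguments.
Unset Strict Implicit.
Unset Printing Implicit Defensive.

Import Order.TTheory GRing.Theory Num.Theory.

Local Open Scope ring_scope.
Local Open Scope complex_scope.

(* All vectors of the plane are elements of R[i]; real scalars are embedded
   by %:C.  The norm `|z| of z : R[i] is itself an element of R[i]. *)

Record fourbar (R : realType) := FourBar {
  base : R;
  len1 : R; len2 : R; len3 : R;
  mass1 : R; mass2 : R; mass3 : R;
  inertia1 : R; inertia2 : R; inertia3 : R;
  (* centre of mass of link j: start of the link + radj * dirj * zj *)
  rad1 : R; rad2 : R; rad3 : R;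
  dir1 : R[i]; dir2 : R[i]; dir3 : R[i]
}.

Definition admissible (R : realType) (M : fourbar R) : Prop :=
  [/\ [/\ 0 < base M, 0 < len1 M, 0 < len2 M & 0 < len3 M],
      [/\ 0 < mass1 M, 0 < mass2 M & 0 < mass3 M],
      [/\ 0 < inertia1 M, 0 < inertia2 M & 0 < inertia3 M],
      [/\ 0 <= rad1 M, 0 <= rad2 M & 0 <= rad3 M] &
      [/\ `|dir1 M| = 1, `|dir2 M| = 1 & `|dir3 M| = 1]].

Definition inner (R : realType) (a b : R[i]) : R := complex.Re (a * b^*).

Section Mechanism.
Variables (R : realType) (M : fourbar R).
Implicit Types z : R[i].

Definition G1 : R := - len1 M / len3 M.
Definition G2 : R := len2 M / len3 M.
Definition G3 : R := base M / len3 M.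

Definition coupler z1 z2 : R[i] := G1%:C * z1 + G2%:C * z2 + G3%:C.

Definition G z1 z2 : R[i] :=
  (G1%:C * z1 + G2%:C * z2 + G3%:C)
  * (G1%:C * z1^-1 + G2%:C * z2^-1 + G3%:C) - 1.

Definition configuration z1 z2 : Prop :=
  [/\ `|z1| = 1, `|z2| = 1 & G z1 z2 = 0].

Definition K1 z1 z2 : R[i] :=
  (G1 * G2)%:C * (z1 * z2^-1 - z1^-1 * z2) + (G1 * G3)%:C * (z1 - z1^-1).

Definition K2 z1 z2 : R[i] :=
  (G1 * G2)%:C * (z1^-1 * z2 - z1 * z2^-1) + (G2 * G3)%:C * (z2 - z2^-1).

Definition q1 : R[i] := (mass1 M * rad1 M)%:C * dir1 M.
Definition q2 : R[i] := (mass2 M * rad2 M)%:C * dir2 M.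
Definition q3 : R[i] := (mass3 M * rad3 M)%:C * dir3 M.

Definition J1 : R := inertia1 M + mass1 M * rad1 M ^+ 2.
Definition J2 : R := inertia2 M + mass2 M * rad2 M ^+ 2.
Definition J3 : R := inertia3 M + mass3 M * rad3 M ^+ 2.

Definition F1 : R[i] := q1 + (mass3 M * len1 M)%:C + G1%:C * q3.
Definition F2 : R[i] := q2 + G2%:C * q3.
Definition F3 : R[i] := (mass2 M * base M)%:C + G3%:C * q3.

Definition center_of_mass z1 z2 : R[i] :=
  ((mass1 M)%:C * ((rad1 M)%:C * dir1 M * z1)
   + (mass2 M)%:C * ((base M)%:C + (rad2 M)%:C * dir2 M * z2)
   + (mass3 M)%:C * ((len1 M)%:C * z1
                     + (rad3 M)%:C * dir3 M * coupler z1 z2))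
  / (mass1 M + mass2 M + mass3 M)%:C.

(* w1, w2, w3 are the angular velocities of the links. *)
Definition angular_momentum z1 z2 z3 (w1 w2 w3 : R) : R :=
  J1 * w1
  + (inner (base M)%:C ((mass2 M * rad2 M)%:C * dir2 M * z2) + J2) * w2
  + inner ((len1 M)%:C * z1 + (rad3 M)%:C * dir3 M * z3)
      ((mass3 M)%:C * ((len1 M)%:C * z1 * w1%:C
                       + (rad3 M)%:C * dir3 M * z3 * w3%:C))
  + inertia3 M * w3.

(* K3 and K4 are the coefficients of w1 and w2 in the angular momentum after
   elimination of z3 and w3; see angular_momentumE below. *)
Definition K3 z1 z2 : R :=
  J1
  + inner ((len1 M)%:C * z1 + (rad3 M)%:C * dir3 M * coupler z1 z2)
      ((mass3 M)%:C * ((len1 M)%:C * z1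
                       + (rad3 M)%:C * dir3 M * (G1%:C * z1)))
  + inertia3 M * inner (coupler z1 z2) (G1%:C * z1).

Definition K4 z1 z2 : R :=
  inner (base M)%:C ((mass2 M * rad2 M)%:C * dir2 M * z2) + J2
  + inner ((len1 M)%:C * z1 + (rad3 M)%:C * dir3 M * coupler z1 z2)
      ((mass3 M)%:C * ((rad3 M)%:C * dir3 M * (G2%:C * z2)))
  + inertia3 M * inner (coupler z1 z2) (G2%:C * z2).

Definition K z1 z2 : R[i] :=
  K1 z1 z2 * (K4 z1 z2)%:C - K2 z1 z2 * (K3 z1 z2)%:C.

Definition dynamically_balanced : Prop :=
  exists S : set (R[i] * R[i]),
    [/\ infinite_set S,
        forall z1 z2, S (z1, z2) -> configuration z1 z2 /\ z1 <> z2,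
        exists c : R[i], forall z1 z2, S (z1, z2) -> F1 * z1 + F2 * z2 = c &
        forall z1 z2, S (z1, z2) -> K z1 z2 = 0].

Lemma center_of_massE z1 z2 :
  center_of_mass z1 z2 =
  (F1 * z1 + F2 * z2 + F3) / (mass1 M + mass2 M + mass3 M)%:C.
Proof.
rewrite /center_of_mass /F1 /F2 /F3 /q1 /q2 /q3 /coupler !rmorphM /=.
by congr (_ / _); ring.
Qed.

Lemma innerDr (a b c : R[i]) : inner a (b + c) = inner a b + inner a c.
Proof. by rewrite /inner rmorphD mulrDr raddfD. Qed.

Lemma innerZr (x : R) (a b : R[i]) : inner a (b * x%:C) = inner a b * x.
Proof. by case: a b => [a a'] [b b']; rewrite /inner /=; ring. Qed.

Lemma angular_momentumE z1 z2 (w1 w2 w3 : R) :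
  `|coupler z1 z2| = 1 ->
  coupler z1 z2 * w3%:C = G1%:C * z1 * w1%:C + G2%:C * z2 * w2%:C ->
  angular_momentum z1 z2 (coupler z1 z2) w1 w2 w3
  = K3 z1 z2 * w1 + K4 z1 z2 * w2.
Proof.
move=> n1 e3.
have w3E : w3 = inner (coupler z1 z2) (G1%:C * z1) * w1
                + inner (coupler z1 z2) (G2%:C * z2) * w2.
  rewrite -!innerZr -innerDr -e3 innerZr /inner -sqr_normc n1 expr1n /=.
  by rewrite mul1r.
rewrite /angular_momentum -[_ * coupler z1 z2 * w3%:C]mulrA e3 {}w3E /K3 /K4.
set u := (X in inner X (_ * (_ + _))).
have -> : (mass3 M)%:C * ((len1 M)%:C * z1 * w1%:C + (rad3 M)%:C * dir3 M
            * (G1%:C * z1 * w1%:C + G2%:C * z2 * w2%:C))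
  = (mass3 M)%:C * ((len1 M)%:C * z1 + (rad3 M)%:C * dir3 M * (G1%:C * z1))
      * w1%:C
    + (mass3 M)%:C * ((rad3 M)%:C * dir3 M * (G2%:C * z2)) * w2%:C by ring.
by rewrite innerDr !innerZr; ring.
Qed.

End Mechanism.

(* Main.v *)
(* Put g = l / d.  Off the diagonal z1 = z2 the constraint G = 0 becomes
   z1 z2 + g (z1 - z2) = 1, so z2 is the Moebius image (1 - g z1) / (z1 - g) of
   z1, and z3 = z1 z2.  A stationary centre of mass is then a quadratic equation
   in z1 with infinitely many roots; its three coefficients vanish, and g^2 <> 1
   gives F1 = F2 = 0.  Dividing the mode equation by z1 or by z2 makes z1 / z2
   affine in z1, z2 and their inverses, so that K reduces to
     2 i g (beta Im z2 + alpha Im z1 - 2 l Im q3 Im z1 Im z2)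
   with alpha, beta constant.  Since Im z2 / Im z1 is
   (g^2 - 1) / (1 + g^2 - 2 g Re z1), the equation K = 0 puts z1 on a real line;
   a line meets the unit circle in finitely many points, hence alpha, beta and
   Im q3 vanish, and these are the stated conditions.
   Conversely they make K vanish on the whole infinite curve. *)
Require Import Defs.
From mathcomp Require Import all_boot all_order all_algebra.
From mathcomp Require Import complex.
From mathcomp Require Import classical_sets cardinality reals.
From mathcomp Require Import boolp ring lra.

Set Implicit Arguments.
Unset Strict Implicit.
Unset Printing Implicit Defensive.

Import Order.TTheory GRing.Theory Num.Theory.
Local Open Scope ring_scope.
Local Open Scope complex_scope.

(** * Polynomials with infinitely many roots *)

Lemma infinite_roots_eq0 (F : idomainType) (p : {poly F}) (A : set F) :
  infinite_set A -> (forall z, A z -> root p z) -> p = 0.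
Proof.
move=> infA rootA; apply/eqP/negPn/negP => p0.
have [B BA sB] := infinite_set_fset (size p) infA.
suff : (size (finmap.enum_fset B) < size p)%N by rewrite ltnNge sB.
apply: max_poly_roots p0 _ _; last exact: finmap.fset_uniq.
by apply/allP => z zB; apply/rootA/BA.
Qed.

Lemma infinite_quadratic (F : idomainType) (a b c : F) (A : set F) :
  infinite_set A -> (forall z, A z -> a * z ^+ 2 + b * z + c = 0) ->
  [/\ a = 0, b = 0 & c = 0].
Proof.
move=> infA rootA.
have p0 : Poly [:: c; b; a] = 0.
  apply: infinite_roots_eq0 infA _ => z /rootA e; apply/rootP.
  by rewrite horner_Poly /= -[RHS]e; ring.
have coefp i : [:: c; b; a]`_i = 0 by rewrite -coef_Poly p0 coef0.
by split; [exact: (coefp 2%N) | exact: (coefp 1%N) | exact: (coefp 0%N)].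
Qed.

(** * Unit complex numbers in coordinates *)

Section UnitCircle.
Variable R : realType.
Implicit Types z w : R[i].

Lemma normc1P z :
  `|z| = 1 <-> complex.Re z ^+ 2 + complex.Im z ^+ 2 = 1.
Proof.
have nE : `|z| ^+ 2 = (complex.Re z ^+ 2 + complex.Im z ^+ 2)%:C.
  by rewrite normc_def -rmorphXn /= sqr_sqrtr // addr_ge0 ?sqr_ge0.
split=> [z1 | e].
  by move: nE; rewrite z1 expr1n => -[<-].
by apply/eqP; rewrite -sqrp_eq1 ?normr_ge0 // nE e.
Qed.

Lemma unit_neq0 z : `|z| = 1 -> z != 0.
Proof. by move=> z1; rewrite -normr_eq0 z1 oner_eq0. Qed.

Lemma unit_invE z : `|z| = 1 -> z^-1 = complex.Re z -i* complex.Im z.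
Proof. by move=> z1; rewrite invc_norm z1 expr1n invr1 mul1r; case: z {z1}. Qed.

Lemma innerE z w :
  inner z w = complex.Re z * complex.Re w + complex.Im z * complex.Im w.
Proof. by case: z w => [a b] [c d]; rewrite /inner /=; ring. Qed.

(** On the unit circle, multiplying the equation of the line by [2 * z] turns it into a complex
    quadratic in [z], with coefficients [u - iv], [2w], [u + iv]. *)
Lemma infinite_chord (u v w : R) (A : set R[i]) :
  infinite_set A ->
  (forall z, A z -> `|z| = 1 /\ u * complex.Re z + v * complex.Im z + w = 0) ->
  [/\ u = 0, v = 0 & w = 0].
Proof.
move=> infA chordA.
have [] := infinite_quadratic (a := u -i* v) (b := (2 * w)%:C)
  (c := u +i* v) infA.
  move=> [x y] /chordA[/normc1P /= z1 e].
  have -> : w = - (u * x + v * y) by rewrite -[LHS]subr0 -e; ring.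
  transitivity ((u +i* v) * (1 - (x ^+ 2 + y ^+ 2))%:C); last first.
    by rewrite z1 subrr mulr0.
  by apply/eqP; rewrite eq_complex expr2 /=; apply/andP; split; apply/eqP; ring.
by move=> [u0 v0] [w0] _; split=> //; lra.
Qed.

End UnitCircle.

(* The factor of G left after dividing out z1 - z2, which G contains because
   G1 = - G2; in this mode the coupler satisfies z3 = z1 * z2. *)
Definition antiparallel (R : realType) (g : R) (z1 z2 : R[i]) :=
  z1 * z2 + g%:C * (z1 - z2) = 1.

Section AntiparallelQuotients.
Variables (R : realType) (g : R).
Implicit Types z : R[i].

Lemma antiparallel_divl z1 z2 :
  z1 != 0 -> antiparallel g z1 z2 -> g%:C * (z2 / z1) = z2 + g%:C - z1^-1.
Proof.
move=> z10 e; apply: (mulIf z10).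
by rewrite !mulrBl mulrA !mulfVK ?mulVf // -e; ring.
Qed.

Lemma antiparallel_divr z1 z2 :
  z2 != 0 -> antiparallel g z1 z2 -> g%:C * (z1 / z2) = z2^-1 + g%:C - z1.
Proof.
move=> z20 e; apply: (mulIf z20).
by rewrite mulrBl mulrDl mulrA !mulfVK ?mulVf // -e; ring.
Qed.

End AntiparallelQuotients.

(** * Momentum coefficients in the antiparallel mode *)

Section Antiparallelogram.
Variables (R : realType) (M : fourbar R) (g : R).
Hypotheses (G1E : G1 M = - g) (G2E : G2 M = g) (G3E : G3 M = 1).
Implicit Types z : R[i].

Lemma coupler_antiparallel z1 z2 :
  antiparallel g z1 z2 -> coupler M z1 z2 = z1 * z2.
Proof.
rewrite /antiparallel /coupler G1E G2E G3E rmorphN rmorph1 => <-; ring.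
Qed.

Lemma configuration_antiparallel z1 z2 : g != 0 -> z1 <> z2 ->
  configuration M z1 z2 <-> [/\ `|z1| = 1, `|z2| = 1 & antiparallel g z1 z2].
Proof.
move=> g0 z12.
have z21 : z2 - z1 != 0 by rewrite subr_eq0 eq_sym; apply/eqP.
have gC0 : g%:C != 0 by apply: contraNneq g0 => -[->].
have GE : `|z1| = 1 -> `|z2| = 1 ->
    G M z1 z2 = g%:C * (z2 - z1) / (z1 * z2)
                * (z1 * z2 + g%:C * (z1 - z2) - 1).
  move=> /unit_neq0 z10 /unit_neq0 z20.
  by rewrite /G G1E G2E G3E rmorphN; field; apply/andP.
split=> -[u1 u2 e]; split=> //; move: e; rewrite /antiparallel GE //.
  have /unit_neq0 z10 := u1; have /unit_neq0 z20 := u2.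
  have c0 : g%:C * (z2 - z1) / (z1 * z2) != 0.
    by rewrite !mulf_neq0 // invr_neq0 // mulf_neq0.
  by move/eqP; rewrite mulf_eq0 (negPf c0) subr_eq0 => /eqP.
by move->; rewrite subrr mulr0.
Qed.

(** Since [z3 = z1 * z2], all vectors in the inner products share the rotation [z1], which cancels
    and leaves only [z2]. *)
Lemma K3_antiparallel z1 z2 :
  `|dir3 M| = 1 -> `|z1| = 1 -> antiparallel g z1 z2 ->
  K3 M z1 z2 = J1 M + mass3 M * len1 M ^+ 2 - g * len1 M * complex.Re (q3 M)
    + complex.Re (((len1 M)%:C * q3 M - (g * J3 M)%:C) * z2).
Proof.
move=> p1 u1 e; rewrite /K3 coupler_antiparallel // G1E /q3 /J3.
case: (dir3 M) z1 z2 p1 u1 {e} =>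
  [px py] [x1 y1] [x2 y2] /normc1P /= p1 /normc1P /= u1.
have {}p1 : py ^+ 2 = 1 - px ^+ 2 by rewrite -p1; ring.
have {}u1 : y1 ^+ 2 = 1 - x1 ^+ 2 by rewrite -u1; ring.
by rewrite !innerE /=; ring: p1 u1.
Qed.

(** [F2 M = 0] turns [q2] into [- g * q3]. The terms in [z2] then combine to the real part of
    [l * q3 * (g * z2 / z1 - z2)], where [antiparallel_divl] replaces the bracket by [g - z1^-1]. *)
Lemma K4_antiparallel z1 z2 :
  `|dir3 M| = 1 -> `|z1| = 1 -> `|z2| = 1 -> antiparallel g z1 z2 -> F2 M = 0 ->
  base M * g = len1 M ->
  K4 M z1 z2 = J2 M + g * len1 M * complex.Re (q3 M)
    - inner ((len1 M)%:C * q3 M - (g * J3 M)%:C) z1.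
Proof.
move=> p1 u1 u2 e F20 lE; rewrite /K4 coupler_antiparallel // G2E.
have -> : (mass2 M * rad2 M)%:C * dir2 M = - g%:C * q3 M.
  by apply/eqP; rewrite mulNr -addr_eq0 -F20 /F2 G2E.
have := antiparallel_divl (unit_neq0 u1) e.
rewrite unit_invE // /q3 /J3 -lE.
case: (dir3 M) z1 z2 p1 u1 u2 {e} =>
  [px py] [x1 y1] [x2 y2] /normc1P /= p1 /normc1P /= u1 /normc1P /= u2 [c1 c2].
have {}p1 : py ^+ 2 = 1 - px ^+ 2 by rewrite -p1; ring.
have {}u2 : y2 ^+ 2 = 1 - x2 ^+ 2 by rewrite -u2; ring.
(* [c1] and [c2] are the real and imaginary parts of [antiparallel_divl]. *)
have {}c1 : g * (x2 * x1 + y2 * y1) = x2 + g - x1 by lra.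
have {}c2 : g * (y2 * x1 - x2 * y1) = y2 + y1 by lra.
rewrite !innerE /=.
transitivity (J2 M + g * (inertia3 M + mass3 M * rad3 M ^+ 2) * x1
  + base M * g * (mass3 M * rad3 M)
    * (px * (g * (x2 * x1 + y2 * y1) - x2)
       - py * (g * (y2 * x1 - x2 * y1) - y2))).
  by ring: p1 u2.
by rewrite c1 c2; ring.
Qed.

(** [K1] and [K2] reduce to [2ig Im z2] and [- 2ig Im z1], so [K] is [2ig (K4 Im z2 + K3 Im z1)]. *)
Lemma K_antiparallel z1 z2 :
  `|dir3 M| = 1 -> `|z1| = 1 -> `|z2| = 1 -> antiparallel g z1 z2 -> F2 M = 0 ->
  base M * g = len1 M ->
  K M z1 z2 = 0 +i* (2 * g *
    ((J2 M + J3 M + (g * len1 M - base M) * complex.Re (q3 M)) * complex.Im z2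
     + (J1 M + J3 M + mass3 M * len1 M ^+ 2
        - (g * len1 M + base M) * complex.Re (q3 M)) * complex.Im z1
     - 2 * len1 M * complex.Im (q3 M) * complex.Im z1 * complex.Im z2)).
Proof.
move=> p1 u1 u2 e F20 lE; rewrite /K K3_antiparallel // K4_antiparallel //.
have z10 := unit_neq0 u1; have z20 := unit_neq0 u2.
have chord : g%:C * (z1 * z2^-1 - z1^-1 * z2) = z1^-1 - z1 + z2^-1 - z2.
  rewrite [z1^-1 * z2]mulrC mulrBr (antiparallel_divl z10 e).
  by rewrite (antiparallel_divr z20 e); ring.
have -> : K1 M z1 z2 = g%:C * (z2 - z2^-1).
  transitivity (- g%:C * (g%:C * (z1 * z2^-1 - z1^-1 * z2))
                - g%:C * (z1 - z1^-1)); last by rewrite chord; ring.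
  by rewrite /K1 G1E G2E G3E !rmorphM rmorphN rmorph1 /=; ring.
have -> : K2 M z1 z2 = g%:C * (z1^-1 - z1).
  transitivity (g%:C * (g%:C * (z1 * z2^-1 - z1^-1 * z2))
                + g%:C * (z2 - z2^-1)); last by rewrite chord; ring.
  rewrite /K2 G1E G2E G3E !rmorphM rmorphN rmorph1 /=; ring.
move: chord; rewrite !unit_invE // -lE {lE F20}.
case: (q3 M) z1 z2 {z10 z20 u1 u2 e} => [a b] [x1 y1] [x2 y2] /= [_ c].
rewrite !innerE /=.
(* The imaginary part of [chord] makes the cross product of [z1] and [z2] linear in [y1] and
   [y2]. *)
have {}c : g * (y1 * x2 - x1 * y2) = - (y1 + y2) by lra.
apply/eqP; rewrite eq_complex /=; apply/andP; split; apply/eqP; first by ring.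
transitivity (2 * g *
  (y2 * (J2 M + g * (base M * g) * a - base M * g * b * y1)
   + y1 * (J1 M + mass3 M * (base M * g) ^+ 2 - g * (base M * g) * a
           - base M * g * b * y2)
   + (base M * a - J3 M) * (g * (y1 * x2 - x1 * y2)))); first by ring.
by rewrite c; ring.
Qed.

End Antiparallelogram.

(** * Geometry of the antiparallel curve *)

Section AntiparallelCurve.
Variables (R : realType) (g : R).
Hypothesis g2 : g ^+ 2 != 1.
Implicit Types z : R[i].

Let unit_subg_neq0 z : `|z| = 1 -> z - g%:C != 0.
Proof.
move=> /normc1P u; rewrite subr_eq0; apply: contraNneq g2 => zg.
by rewrite -u zg /= expr0n addr0.
Qed.

Lemma antiparallelP z1 z2 : `|z1| = 1 ->
  antiparallel g z1 z2 <-> z2 = (1 - g%:C * z1) / (z1 - g%:C).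
Proof.
move=> u1; rewrite /antiparallel; split=> [e | ->]; last first.
  by field; exact: unit_subg_neq0.
apply: (canRL (mulfK (unit_subg_neq0 u1))).
by rewrite -e; ring.
Qed.

(** Take imaginary parts in [z2 * (z1 - g) = 1 - g * z1] after multiplying by the conjugate of
    [z1 - g]; the factor on the left is the squared modulus of [z1 - g]. *)
Lemma antiparallel_Im z1 z2 : `|z1| = 1 -> antiparallel g z1 z2 ->
  complex.Im z2 * (1 + g ^+ 2 - 2 * g * complex.Re z1)
  = (g ^+ 2 - 1) * complex.Im z1.
Proof.
case: z1 z2 => [x1 y1] [x2 y2] /normc1P /= u [re im].
transitivity ((x1 - g) * (x1 * y2 + y1 * x2 + (g * (y1 - y2) + 0 * (x1 - x2)))
  - y1 * (x1 * x2 - y1 * y2 + (g * (x1 - x2) - 0 * (y1 - y2)))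
  + g ^+ 2 * y1 + y2 * (1 - (x1 ^+ 2 + y1 ^+ 2))); first by ring.
by rewrite re im u; ring.
Qed.

(** A real [z1] on the circle is 1 or -1, and these are the fixed points of the Moebius map. *)
Lemma antiparallel_Im_neq0 z1 z2 : `|z1| = 1 -> antiparallel g z1 z2 ->
  z1 <> z2 -> complex.Im z1 != 0.
Proof.
move=> u1 e; apply: contra_notN => /eqP y0.
have z1K : z1 * z1 = 1.
  rewrite -(mulfV (unit_neq0 u1)) unit_invE //.
  by case: z1 y0 {e u1} => ? ? /= ->; rewrite oppr0.
rewrite [RHS](antiparallelP _ u1).1 //.
apply: (canRL (mulfK (unit_subg_neq0 u1))).
by rewrite -[X in _ = X - _]z1K; ring.
Qed.

Lemma antiparallel_partner z1 (z2 := (1 - g%:C * z1) / (z1 - g%:C)) :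
  `|z1| = 1 -> complex.Im z1 != 0 ->
  [/\ `|z2| = 1, antiparallel g z1 z2 & z1 <> z2].
Proof.
move=> u1 y0; have z1g := unit_subg_neq0 u1.
have e : antiparallel g z1 z2 by apply/antiparallelP.
split=> //.
  have conjE : Num.conj (z1 - g%:C) = z1^-1 - g%:C.
    rewrite unit_invE //; case: z1 {u1 y0 z2 z1g e} => a b /=.
    by congr (_ +i* _); ring.
  (* A number divided into its own conjugate has modulus 1. *)
  have -> : z2 = z1 * (Num.conj (z1 - g%:C) / (z1 - g%:C)).
    by rewrite conjE /z2; field; rewrite z1g unit_neq0.
  by rewrite normrM u1 mul1r normrM normfV norm_conjC mulfV ?normr_eq0.
move=> z12; move: e; rewrite -z12 /antiparallel subrr mulr0 addr0.
case: z1 u1 y0 {z1g z2 z12} => x y /normc1P /= u y0 [re _].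
have /eqP : y ^+ 2 = 0 by lra.
by rewrite sqrf_eq0 (negPf y0).
Qed.

Lemma infinite_antiparallel :
  infinite_set [set z : R[i] * R[i] |
    [/\ `|z.1| = 1, `|z.2| = 1, antiparallel g z.1 z.2 & z.1 <> z.2]].
Proof.
(* Rational parametrisation of the circle; the shift to [n.+1] keeps [t] nonzero, hence [z n] off
   the real axis, and [zK] recovers [t]. *)
pose t (n : nat) : R := n.+1%:R.
pose z n := (t n ^+ 2 - 1) / (t n ^+ 2 + 1) +i* (2 * t n / (t n ^+ 2 + 1)).
have t0 n : t n != 0 by rewrite pnatr_eq0.
have t2 n : t n ^+ 2 + 1 != 0 by rewrite lt0r_neq0 // ltr_wpDl ?sqr_ge0.
have u n : `|z n| = 1 by apply/normc1P => /=; move: (t n) (t2 n) => s s2; field.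
have y0 n : complex.Im (z n) != 0.
  by rewrite /= !mulf_neq0 ?invr_neq0 ?pnatr_eq0.
have zK n : (1 + complex.Re (z n)) / complex.Im (z n) = t n.
  by rewrite /=; move: (t n) (t0 n) (t2 n) => s s0 s2; field; rewrite s2 s0.
pose f n := (z n, (1 - g%:C * z n) / (z n - g%:C)).
have f_inj : injective f.
  move=> n m /(congr1 fst) /= nm; move/eqP: (zK n).
  by rewrite nm zK eqr_nat => /eqP[].
move=> /(finite_preimage (f := f) (in2W f_inj)) fin; apply: infinite_nat.
apply: sub_finite_set fin => n _ /=.
by have [? ? ?] := antiparallel_partner (u n) (y0 n).
Qed.

End AntiparallelCurve.

(** * The balancing conditions *)

Theorem mainTheorem2 (R : realType) (M : fourbar R) (l d : R)
  (hM : admissible M)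
  (hl1 : len1 M = l) (hl2 : len2 M = l) (hl3 : len3 M = d) (hd : base M = d)
  (hld : l <> d) :
  dynamically_balanced M <->
  [/\ q1 M = (l / d)%:C * q3 M - (l * mass3 M)%:C,
      q2 M = - (l / d)%:C * q3 M,
      (J1 M)%:C = ((d ^+ 2 + l ^+ 2) / d)%:C * q3 M - (J3 M)%:C
                  - (l ^+ 2 * mass3 M)%:C &
      (J2 M)%:C = ((d ^+ 2 - l ^+ 2) / d)%:C * q3 M - (J3 M)%:C].
Proof.
have [[d0 l0 _ _] _ _ _ [_ _ p1]] := hM; rewrite hd in d0; rewrite hl1 in l0.
have dN0 := lt0r_neq0 d0; pose g := l / d.
have g0 : 0 < g by rewrite divr_gt0.
have gN0 := lt0r_neq0 g0.
have G1E : G1 M = - g by rewrite /G1 hl1 hl3 mulNr.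
have G2E : G2 M = g by rewrite /G2 hl2 hl3.
have G3E : G3 M = 1 by rewrite /G3 hd hl3 divff.
have baseE : base M * g = len1 M by rewrite hd hl1 /g; field.
have g2 : g ^+ 2 != 1.
  rewrite sqrp_eq1 ?ltW //; apply/eqP => g1; apply: hld.
  by rewrite -[LHS](divfK dN0) -/g g1 mul1r.
pose beta := J2 M + J3 M + (g * len1 M - base M) * complex.Re (q3 M).
pose alpha := J1 M + J3 M + mass3 M * len1 M ^+ 2
              - (g * len1 M + base M) * complex.Re (q3 M).
(* As [J1] is real and [g * l + d] is positive, the imaginary part of the third equation forces
   [Im q3 = 0]; the real parts of the last two are [alpha = 0] and [beta = 0]. *)
have -> : [/\ q1 M = (l / d)%:C * q3 M - (l * mass3 M)%:C,
      q2 M = - (l / d)%:C * q3 M,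
      (J1 M)%:C = ((d ^+ 2 + l ^+ 2) / d)%:C * q3 M - (J3 M)%:C
                  - (l ^+ 2 * mass3 M)%:C &
      (J2 M)%:C = ((d ^+ 2 - l ^+ 2) / d)%:C * q3 M - (J3 M)%:C]
  = [/\ F1 M = 0 /\ F2 M = 0, alpha = 0, beta = 0 & complex.Im (q3 M) = 0].
  have plusE : (d ^+ 2 + l ^+ 2) / d = g * len1 M + base M.
    by rewrite hl1 hd /g; field.
  have minusE : (d ^+ 2 - l ^+ 2) / d = base M - g * len1 M.
    by rewrite hl1 hd /g; field.
  have plusN0 : g * len1 M + base M != 0.
    by rewrite hl1 hd; exact: lt0r_neq0 (addr_gt0 (mulr_gt0 g0 l0) d0).
  rewrite plusE minusE -/g /F1 /F2 G1E G2E /alpha /beta hl1 hd.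
  rewrite hl1 hd in plusN0.
  apply/propext; split.
    move=> [-> -> e3 e4].
    have [re3 im3] : complex.Re (q3 M) * (g * l + d) - J3 M - l ^+ 2 * mass3 M
        = J1 M /\ complex.Im (q3 M) * (g * l + d) = 0.
      move: e3; case: (q3 M) => a b /= [-> im].
      by split; [|rewrite [RHS]im]; ring.
    have re4 : complex.Re (q3 M) * (d - g * l) - J3 M = J2 M.
      by move: e4; case: (q3 M) => a b /= [-> _]; ring.
    split; [split | lra | lra |].
    - by rewrite rmorphN !rmorphM /=; ring.
    - by ring.
    - by move/eqP: im3; rewrite mulf_eq0 (negPf plusN0) orbF => /eqP.
  move=> [[/eqP e1 /eqP e2] ea eb e3]; split.
  - apply/eqP; rewrite -subr_eq0 -(eqP e1) rmorphN !rmorphM; apply/eqP; ring.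
  - apply/eqP; rewrite -subr_eq0 -(eqP e2); apply/eqP; ring.
  - move: ea e3; case: (q3 M) => a b /= ea ->.
    by apply/eqP; rewrite eq_complex /=; apply/andP; split; apply/eqP; lra.
  - move: eb e3; case: (q3 M) => a b /= eb ->.
    by apply/eqP; rewrite eq_complex /=; apply/andP; split; apply/eqP; lra.
have KE z1 z2 : `|z1| = 1 -> `|z2| = 1 -> antiparallel g z1 z2 -> F2 M = 0 ->
    K M z1 z2 = 0 +i* (2 * g * (beta * complex.Im z2 + alpha * complex.Im z1
      - 2 * len1 M * complex.Im (q3 M) * complex.Im z1 * complex.Im z2)).
  by move=> u1 u2 e F20; exact: K_antiparallel.
have confE z1 z2 : z1 <> z2 -> configuration M z1 z2 <->
    [/\ `|z1| = 1, `|z2| = 1 & antiparallel g z1 z2].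
  by move=> ?; exact: configuration_antiparallel.
clearbody alpha beta g.
split; last first.
  move=> [[F10 F20] alpha0 beta0 b0].
  exists [set z : R[i] * R[i] |
    [/\ `|z.1| = 1, `|z.2| = 1, antiparallel g z.1 z.2 & z.1 <> z.2]]%classic.
  split.
  - exact: infinite_antiparallel.
  - by move=> z1 z2 [/= u1 u2 e z12]; split=> //; apply/confE.
  - by exists 0 => z1 z2 _; rewrite F10 F20 !mul0r addr0.
  - move=> z1 z2 [/= u1 u2 e _]; rewrite KE // alpha0 beta0 b0.
    by rewrite !(mul0r, mulr0, addr0, subr0).
move=> [S [infS confS [c comS] KS]].
have modeS z1 z2 : S (z1, z2) -> [/\ `|z1| = 1, `|z2| = 1,
    antiparallel g z1 z2 & z1 <> z2].
  by move=> /confS[/[swap] ? /confE[]].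
(* Since [z1] determines [z2], infinitely many configurations give infinitely many values of
   [z1]. *)
have infS1 : infinite_set (fst @` S).
  move=> finS1; apply: infS.
  apply: sub_finite_set (finite_image
    (fun z => (z, (1 - g%:C * z) / (z - g%:C))) finS1) => -[z1 z2] Sz.
  exists z1; first by exists (z1, z2).
  by have [u1 _ /(antiparallelP g2 _ u1) -> _] := modeS _ _ Sz.
(* These are the coefficients of [(F1 * z1 + F2 * z2 - c) * (z1 - g)] once [z2 * (z1 - g)] is
   replaced by [1 - g * z1]. *)
have [F10 F2c cF2] : [/\ F1 M = 0, - (g%:C * F1 M + g%:C * F2 M + c) = 0
    & F2 M + c * g%:C = 0].
  apply: infinite_quadratic infS1 _ => _ [[z1 z2] Sz <-] /=.
  have [u1 _ e _] := modeS _ _ Sz; move: (comS _ _ Sz) e.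
  rewrite /antiparallel => <- e.
  transitivity (F2 M * (1 - (z1 * z2 + g%:C * (z1 - z2)))); first by ring.
  by rewrite e subrr mulr0.
have F20 : F2 M = 0.
  have gC2 : 1 - g%:C ^+ 2 != 0.
    by rewrite subr_eq0 eq_sym -rmorphXn; apply: contraNneq g2 => -[->].
  apply: (mulIf gC2); rewrite mul0r -[RHS]cF2 -[LHS]subr0 -[in LHS](mulr0 g%:C).
  by rewrite -F2c F10; ring.
(* The line comes from multiplying the bracket of [KE] by [1 + g ^+ 2 - 2 * g * Re z1], eliminating
   [Im z2] by [antiparallel_Im], and cancelling the nonzero [Im z1]. *)
have [] := infinite_chord (u := - 2 * g * alpha)
  (v := - 2 * len1 M * complex.Im (q3 M) * (g ^+ 2 - 1))
  (w := beta * (g ^+ 2 - 1) + alpha * (1 + g ^+ 2)) infS1.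
  move=> _ [[z1 z2] Sz <-] /=; have [u1 u2 e z12] := modeS _ _ Sz.
  split=> //; have y0 := antiparallel_Im_neq0 g2 u1 e z12.
  have := KS _ _ Sz; rewrite KE // => -[/eqP].
  rewrite !mulf_eq0 pnatr_eq0 (negPf gN0) /= => /eqP k0.
  apply: (mulIf y0); rewrite mul0r.
  have := antiparallel_Im u1 e.
  move: k0; set y2 := complex.Im z2; set y1 := complex.Im z1 => k0 yE.
  set x1 := complex.Re z1 in yE *; set b := complex.Im (q3 M) in k0 *.
  transitivity ((beta - 2 * len1 M * b * y1) * ((g ^+ 2 - 1) * y1)
    + alpha * y1 * (1 + g ^+ 2 - 2 * g * x1)); first by ring.
  rewrite -yE -[RHS](mul0r (1 + g ^+ 2 - 2 * g * x1)) -k0; ring.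
have g21 : g ^+ 2 - 1 != 0 by rewrite subr_eq0.
move=> /eqP; rewrite !mulf_eq0 oppr_eq0 pnatr_eq0 (negPf gN0) /= => /eqP alpha0.
move=> /eqP; rewrite !mulf_eq0 oppr_eq0 pnatr_eq0 hl1 (gt_eqF l0) (negPf g21).
rewrite orbF => /eqP b0; rewrite alpha0 mul0r addr0.
by move=> /eqP; rewrite mulf_eq0 (negPf g21) orbF => /eqP beta0.
Qed.
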